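(* Let $M$ be a finite dimensional $C^*$-algebra and let $\Phi\in\mathrm{Mor}(M,M\otimes A)$ be the quantum family of all maps $\mathscr{QS}(M)\to\mathscr{QS}(M)$, regarded as the action on $\mathscr{QS}(M)$ of the quantum semigroup of all maps $\mathscr{QS}(M)\to\mathscr{QS}(M)$. Then this action is ergodic: for any $m\in M$, the condition $\Phi(m)=m\otimes I$ implies $m\in\mathbb{C}I$.
   Context: For $C^*$-algebras $A,B$, $\mathrm{M}(B)$ is the multiplier algebra of $B$ and $\mathrm{Mor}(A,B)$ is the set of nondegenerate $*$-homomorphisms $A\to\mathrm{M}(B)$. Compositions and tensor products of morphisms are understood through canonical extensions to multiplier algebras; $\otimes$ is the minimal tensor product. The quantum family of all maps $\mathscr{QS}(M)\to\mathscr{QS}(M)$ is the pair $(A,\Phi)$, unique up to isomorphism, of a unital $C^*$-algebra $A$ and $\Phi\in\mathrm{Mor}(M,M\otimes A)$ such that for every $C^*$-algebra $D$ and every $\Psi\in\mathrm{Mor}(M,M\otimes D)$ there is a unique $\Lambda\in\mathrm{Mor}(A,D)$ with $(\mathrm{id}\otimes\Lambda)\circ\Phi=\Psi$ (it exists since $M$ is finite dimensional). The quantum semigroup of all maps is $(A,\Delta)$ with $\Delta\in\mathrm{Mor}(A,A\otimes A)$ the unique morphism satisfying $(\Phi\otimes\mathrm{id})\circ\Phi=(\mathrm{id}\otimes\Delta)\circ\Phi$. $I$ denotes the unit. *)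

(* Defs.v *)
From HB Require Import structures.
From mathcomp Require Import all_boot all_order all_algebra.
From mathcomp Require Export complex.
From mathcomp Require Import all_classical reals topology normedtype.
Set Implicit Arguments.
Unset Strict Implicit.
Unset Printing Implicit Defensive.
Import Order.TTheory GRing.Theory Num.Theory.
Import numFieldNormedType.Exports.

Local Open Scope classical_set_scope.
Local Open Scope ring_scope.

Reserved Notation "x ** y" (at level 40, left associativity).

(* C*-algebras over the complex numbers R[i]; no unit is assumed, so the     *)
(* multiplication is a new operation and not that of a MathComp ring.         *)
HB.mixin Record isCStarAlgebra (R : realType) A
    of CompleteNormedModule R[i] A := {
  cmul : A -> A -> A;
  star : A -> A;
  cmulA : associative cmul;
  cmulDl : left_distributive cmul +%R;
  cmulDr : right_distributive cmul +%R;
  cmulZl : forall (c : R[i]) (a b : A), cmul (c *: a) b = c *: cmul a b;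
  cmulZr : forall (c : R[i]) (a b : A), cmul a (c *: b) = c *: cmul a b;
  starD : {morph star : a b / a + b};
  starZ : forall (c : R[i]) (a : A), star (c *: a) = c^* *: star a;
  starM : forall a b : A, star (cmul a b) = cmul (star b) (star a);
  starK : involutive star;
  cmul_norm : forall a b : A, `|cmul a b| <= `|a| * `|b|;
  cstar_norm : forall a : A, `|cmul (star a) a| = `|a| ^+ 2
}.

#[short(type="cstarAlgType")]
HB.structure Definition CStarAlgebra (R : realType) :=
  {A of isCStarAlgebra R A & CompleteNormedModule R[i] A}.

Notation "x ** y" := (cmul x y) : ring_scope.

Section CStarTheory.
Variables (R : realType) (A : cstarAlgType R).
Implicit Types a b x y : A.

Lemma cmul0r a : 0 ** a = 0.
Proof. by apply: (addrI (0 ** a)); rewrite -cmulDl !addr0. Qed.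

Lemma cmulr0 a : a ** 0 = 0.
Proof. by apply: (addrI (a ** 0)); rewrite -cmulDr !addr0. Qed.

Lemma cmulNr a b : a ** - b = - (a ** b).
Proof. by apply/eqP; rewrite -addr_eq0 -cmulDr addNr cmulr0. Qed.

Lemma cmulrN a b : - a ** b = - (a ** b).
Proof. by apply/eqP; rewrite -addr_eq0 -cmulDl addNr cmul0r. Qed.

Lemma star_self0 a : star a ** a = 0 -> a = 0.
Proof.
move=> a0; apply/eqP; rewrite -normr_eq0 -sqrf_eq0.
by rewrite -cstar_norm a0 normr0.
Qed.

Lemma cmul_eql x y : (forall a, a ** x = a ** y) -> x = y.
Proof.
move=> xy; apply/eqP; rewrite -subr_eq0; apply/eqP/star_self0.
by rewrite cmulDr cmulNr xy subrr.
Qed.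

Lemma cmul_eqr x y : (forall a, x ** a = y ** a) -> x = y.
Proof.
move=> xy; apply: (can_inj (@starK R A)); apply: cmul_eql => a.
by rewrite -[a]starK -!starM xy.
Qed.

End CStarTheory.

(* A double centralizer of B. Linearity, boundedness and                      *)
(* lact (a ** b) = lact a ** b are automatic because B is a C*-algebra.       *)
Record multiplier (R : realType) (B : cstarAlgType R) := Multiplier {
  lact : B -> B;
  ract : B -> B;
  multP : forall a b, a ** lact b = ract a ** b
}.

Section MultiplierAlgebra.
Variables (R : realType) (B : cstarAlgType R).
Implicit Types (u v w : multiplier B) (a b : B) (c : R[i]).

HB.instance Definition _ := gen_eqMixin (multiplier B).
HB.instance Definition _ := gen_choiceMixin (multiplier B).

Lemma multiplier_eq u v : lact u =1 lact v -> ract u =1 ract v -> u = v.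
Proof.
case: u v => [l r p] [l' r' p'] /= /funext ll' /funext rr'.
move: p p'; rewrite ll' rr' => p p'.
by rewrite (Prop_irrelevance p p').
Qed.

Lemma lactD u a b : lact u (a + b) = lact u a + lact u b.
Proof. by apply: cmul_eql => x; rewrite cmulDr !multP cmulDr. Qed.

Lemma lactZ u c a : lact u (c *: a) = c *: lact u a.
Proof. by apply: cmul_eql => x; rewrite cmulZr !multP cmulZr. Qed.

Lemma ractD u a b : ract u (a + b) = ract u a + ract u b.
Proof. by apply: cmul_eqr => x; rewrite cmulDl -!multP cmulDl. Qed.

Lemma ractZ u c a : ract u (c *: a) = c *: ract u a.
Proof. by apply: cmul_eqr => x; rewrite cmulZl -!multP cmulZl. Qed.

Fact mult0_subproof a b : a ** (0 : B) = (0 : B) ** b.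
Proof. by rewrite cmulr0 cmul0r. Qed.
Definition mult0 : multiplier B := Multiplier mult0_subproof.

Fact multN_subproof u a b : a ** (- lact u b) = - ract u a ** b.
Proof. by rewrite cmulNr multP cmulrN. Qed.
Definition multN u : multiplier B := Multiplier (multN_subproof u).

Fact multD_subproof u v a b :
  a ** (lact u b + lact v b) = (ract u a + ract v a) ** b.
Proof. by rewrite cmulDr !multP cmulDl. Qed.
Definition multD u v : multiplier B := Multiplier (multD_subproof u v).

Fact multZ_subproof c u a b : a ** (c *: lact u b) = (c *: ract u a) ** b.
Proof. by rewrite cmulZr multP cmulZl. Qed.
Definition multZ c u : multiplier B := Multiplier (multZ_subproof c u).

Definition mult1 : multiplier B := @Multiplier _ B id id (fun _ _ => erefl).

Fact multM_subproof u v a b :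
  a ** lact u (lact v b) = ract v (ract u a) ** b.
Proof. by rewrite !multP. Qed.
Definition multM u v : multiplier B := Multiplier (multM_subproof u v).

Fact mult_star_subproof u a b :
  a ** star (ract u (star b)) = star (lact u (star a)) ** b.
Proof. by rewrite -[a]starK -starM -multP starM !starK. Qed.
Definition mult_star u : multiplier B := Multiplier (mult_star_subproof u).

Fact multDA : associative multD.
Proof. by move=> u v w; apply: multiplier_eq => a; rewrite /= addrA. Qed.
Fact multDC : commutative multD.
Proof. by move=> u v; apply: multiplier_eq => a; rewrite /= addrC. Qed.
Fact multD0 : left_id mult0 multD.
Proof. by move=> u; apply: multiplier_eq => a; rewrite /= add0r. Qed.
Fact multDN : left_inverse mult0 multN multD.
Proof. by move=> u; apply: multiplier_eq => a; rewrite /= addNr. Qed.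
HB.instance Definition _ :=
  GRing.isZmodule.Build (multiplier B) multDA multDC multD0 multDN.

Fact multMA : associative multM.
Proof. by move=> u v w; apply: multiplier_eq. Qed.
Fact mult1M : left_id mult1 multM.
Proof. by move=> u; apply: multiplier_eq. Qed.
Fact multM1 : right_id mult1 multM.
Proof. by move=> u; apply: multiplier_eq. Qed.
Fact multMDl : left_distributive multM +%R.
Proof. by move=> u v w; apply: multiplier_eq => a; rewrite /= ?ractD. Qed.
Fact multMDr : right_distributive multM +%R.
Proof. by move=> u v w; apply: multiplier_eq => a; rewrite /= ?lactD. Qed.
HB.instance Definition _ :=
  GRing.Zmodule_isPzRing.Build (multiplier B)
    multMA mult1M multM1 multMDl multMDr.

Fact multZA c d u : multZ c (multZ d u) = multZ (c * d) u.
Proof. by apply: multiplier_eq => a; rewrite /= scalerA. Qed.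
Fact multZ1 : left_id 1 multZ.
Proof. by move=> u; apply: multiplier_eq => a; rewrite /= scale1r. Qed.
Fact multZDr : right_distributive multZ +%R.
Proof. by move=> c u v; apply: multiplier_eq => a; rewrite /= scalerDr. Qed.
Fact multZDl u : {morph multZ^~ u : c d / c + d}.
Proof. by move=> c d; apply: multiplier_eq => a; rewrite /= scalerDl. Qed.
HB.instance Definition _ :=
  GRing.Zmodule_isLmodule.Build R[i] (multiplier B)
    multZA multZ1 multZDr multZDl.

Fact embed_subproof (x a b : B) : a ** (x ** b) = (a ** x) ** b.
Proof. exact: cmulA. Qed.

(* The inclusion of B in M(B), which is also the identity morphism of B. *)
Definition embed (x : B) : multiplier B :=
  @Multiplier _ B (cmul x) (cmul^~ x) (embed_subproof x).

End MultiplierAlgebra.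

Section Morphisms.
Variable R : realType.
Implicit Types A B C : cstarAlgType R.

(* f belongs to Mor(A, B) *)
Record is_mor A B (f : A -> multiplier B) : Prop := IsMor {
  mor_linear : linear f;
  mor_mul : forall a b, f (a ** b) = f a * f b;
  mor_star : forall a, f (star a) = mult_star (f a);
  mor_nondegenerate :
    dense (range (fun s : seq (A * B) => \sum_(p <- s) lact (f p.1) p.2))
}.

(* G is the canonical extension of g to M(B). *)
Record is_mult_extension B C
    (g : B -> multiplier C) (G : multiplier B -> multiplier C) : Prop :=
  IsMultExtension {
  ext_linear : linear G;
  ext_mul : forall u v, G (u * v) = G u * G v;
  ext_one : G 1 = 1;
  ext_star : forall u, G (mult_star u) = mult_star (G u);
  ext_embed : forall b, G (embed b) = g b
}.

(* k = g \o f as morphisms; the extension of a morphism g exists and is       *)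
(* unique, but it is not available as a total function of g.                  *)
Definition is_mor_comp A B C (g : B -> multiplier C) (f : A -> multiplier B)
    (k : A -> multiplier C) : Prop :=
  exists2 G, is_mult_extension g G & forall a, k a = G (f a).

End Morphisms.

Section MinimalTensorProduct.
Variable R : realType.
Implicit Types A B T S TA TB : cstarAlgType R.

Definition lin_indep (V : lmodType R[i]) n (v : 'I_n -> V) : Prop :=
  forall c : 'I_n -> R[i], \sum_i c i *: v i = 0 -> forall i, c i = 0.

(* t induces an injective *-homomorphism from the algebraic tensor product    *)
(* of A and B to T; equivalently T induces a C*-norm on it. For injectivity,  *)
(* every tensor is a finite sum of a_i (x) b_i with the b_i independent, and  *)
(* it vanishes iff all the a_i do.                                            *)
Record is_tensor_embedding A B T (t : A -> B -> T) : Prop :=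
  IsTensorEmbedding {
  tens_linearl : forall b, linear (t^~ b);
  tens_linearr : forall a, linear (t a);
  tens_mul : forall a a' b b', t (a ** a') (b ** b') = t a b ** t a' b';
  tens_star : forall a b, t (star a) (star b) = star (t a b);
  tens_inj : forall n (a : 'I_n -> A) (b : 'I_n -> B),
    lin_indep b -> \sum_i t (a i) (b i) = 0 -> forall i, a i = 0
}.

Definition tens_sum A B T (t : A -> B -> T) (s : seq (A * B)) : T :=
  \sum_(p <- s) t p.1 p.2.

(* (T, t) is the completion of the algebraic tensor product of A and B for    *)
(* its least C*-norm.                                                         *)
Record is_min_tensor A B T (t : A -> B -> T) : Prop := IsMinTensor {
  min_tens_embedding : is_tensor_embedding t;
  min_tens_dense : dense (range (tens_sum t));
  min_tens_norm : forall S (t' : A -> B -> S), is_tensor_embedding t' ->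
    forall s, `|tens_sum t s| <= `|tens_sum t' s|
}.

(* h = f (x) g, as an element of Mor(A1 (x) A2, B1 (x) B2). The element       *)
(* f a1 (x) g a2 of M(B1) (x) M(B2) is seen in M(B1 (x) B2), as the           *)
(* multiplier acting factorwise on elementary tensors.                        *)
Record is_mor_tensor A1 A2 B1 B2 TA TB
    (tA : A1 -> A2 -> TA) (tB : B1 -> B2 -> TB)
    (f : A1 -> multiplier B1) (g : A2 -> multiplier B2)
    (h : TA -> multiplier TB) : Prop := IsMorTensor {
  mor_tensor_mor : is_mor h;
  mor_tensor_lact : forall a1 a2 b1 b2,
    lact (h (tA a1 a2)) (tB b1 b2) = tB (lact (f a1) b1) (lact (g a2) b2);
  mor_tensor_ract : forall a1 a2 b1 b2,
    ract (h (tA a1 a2)) (tB b1 b2) = tB (ract (f a1) b1) (ract (g a2) b2)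
}.

End MinimalTensorProduct.

Section QuantumMaps.
Variable R : realType.
Implicit Types M A MA AA MAA D MD : cstarAlgType R.

Definition finite_dim M : Prop :=
  exists n (e : 'I_n -> M), forall x, exists c : 'I_n -> R[i],
    x = \sum_i c i *: e i.

Definition is_unit A (u : A) : Prop := forall a, u ** a = a /\ a ** u = a.

(* (A, Phi) is the quantum family of all maps QS(M) -> QS(M), where MA is     *)
(* M (x) A.                                                                   *)
Record quantum_family_of_all_maps M A MA
    (tMA : M -> A -> MA) (Phi : M -> multiplier MA) : Prop :=
  QuantumFamilyOfAllMaps {
  qfam_tensor : is_min_tensor tMA;
  qfam_unital : exists u : A, is_unit u;
  qfam_mor : is_mor Phi;
  qfam_universal : forall D MD (tMD : M -> D -> MD) (Psi : M -> multiplier MD),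
    is_min_tensor tMD -> is_mor Psi ->
    exists! Lambda : A -> multiplier D, is_mor Lambda /\
      exists2 idLambda, is_mor_tensor tMA tMD (@embed R M) Lambda idLambda
        & is_mor_comp idLambda Phi Psi
}.

(* (Phi (x) id) \o Phi = (id (x) Delta) \o Phi, where AA is A (x) A, and MAA  *)
(* is both (M (x) A) (x) A and M (x) (A (x) A): the last condition on the     *)
(* tensor maps makes the identification the associativity isomorphism.        *)
Record quantum_semigroup_of_all_maps M A MA AA MAA
    (tMA : M -> A -> MA) (tAA : A -> A -> AA)
    (tMA_A : MA -> A -> MAA) (tM_AA : M -> AA -> MAA)
    (Phi : M -> multiplier MA) (Delta : A -> multiplier AA) : Prop :=
  QuantumSemigroupOfAllMaps {
  qsem_family : quantum_family_of_all_maps tMA Phi;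
  qsem_tensor : is_min_tensor tAA;
  qsem_tensorl : is_min_tensor tMA_A;
  qsem_tensorr : is_min_tensor tM_AA;
  qsem_tensorA : forall m a b, tMA_A (tMA m a) b = tM_AA m (tAA a b);
  qsem_mor : is_mor Delta;
  qsem_action : exists PhiId idDelta Phi2,
    [/\ is_mor_tensor tMA tMA_A Phi (@embed R A) PhiId,
        is_mor_tensor tMA tM_AA (@embed R M) Delta idDelta,
        is_mor_comp PhiId Phi Phi2 & is_mor_comp idDelta Phi Phi2]
}.

(* The action Phi of the unital quantum semigroup A on QS(M) is ergodic. *)
Definition ergodic M A MA
    (tMA : M -> A -> MA) (Phi : M -> multiplier MA) : Prop :=
  forall (IA : A) (m : M), is_unit IA ->
    Phi m = embed (tMA m IA) ->
    exists2 IM : M, is_unit IM & exists c : R[i], m = c *: IM.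

End QuantumMaps.

(* Main.v *)
Require Import Defs.
From HB Require Import structures.
From mathcomp Require Import all_boot all_order all_algebra.
From mathcomp Require Import all_classical reals topology normedtype.
From mathcomp Require Import ring.

(** Every quantum family of maps factors through Phi, so an element m with
    Phi m = m (x) I is invariant under each of them: Psi m = m (x) q for every
    Psi in Mor(M, M (x) D), where q is the image of I under the morphism from
    A to D. It is enough to use one family, that of the constant maps: D = M
    and Psi m = 1 (x) m. Then 1 (x) m = m (x) q in M (x) M, and comparing
    coefficients of the second factor along a basis vector on which m does not
    vanish shows that m is a multiple of 1 (theorem proposition4p6).

    The universal property only speaks of C*-algebras, so the work is to
    construct the C*-algebra M (x) M and to prove that it is the minimal tensor
    product, without using the classification of finite dimensional
    C*-algebras.

    The trace tau of left multiplication is a faithful positive trace on M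
    (faithful_trace_exists). This needs no spectral theory in M beyond two
    consequences of the implication from star a ** a = 0 to a = 0: a
    self-adjoint element has real eigenvalues, and is zero if nilpotent. Hence M
    is a Hilbert space for tau (star x ** y); an orthonormal basis gives
    coordinates, and the vector representing tau gives a unit (trace_unit).

    The space M (x) M, with tau (x) tau, is again a Hilbert space on which the
    algebra acts by left multiplication; it is normed by the operator norm.
    The spectral theorem provides, for each x, an eigenvector y in the algebra
    itself with star x ** x ** y = |x|^2 y (tnorm_spec). This single fact yields
    the C*-identity, the comparison with the norm of M that gives completeness
    (norm_elt_le, tensor_complete), and the minimality: an injective
    homomorphism theta keeps the eigenvalue |x|^2, so that
    |x|^2 <= |theta (star x ** x)| = |theta x|^2 (tnorm_min). *)

Set Implicit Arguments.
Unset Strict Implicit.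
Unset Printing Implicit Defensive.
Import Order.TTheory GRing.Theory Num.Theory.
Import numFieldNormedType.Exports.
Local Open Scope classical_set_scope.
Local Open Scope ring_scope.
Local Open Scope sesquilinear_scope.

(** * Linear maps given as bare functions *)

Section LinearMaps.
Variables (K : pzRingType) (V W : lmodType K) (h : V -> W).
Hypothesis hl : linear h.

Let g : {linear V -> W} := HB.pack h (GRing.isLinear.Build K V W _ h hl).

Lemma lin0 : h 0 = 0. Proof. exact: (linear0 g). Qed.
Lemma linD x y : h (x + y) = h x + h y. Proof. exact: (linearD g). Qed.
Lemma linB x y : h (x - y) = h x - h y. Proof. exact: (linearB g). Qed.
Lemma linZ c x : h (c *: x) = c *: h x. Proof. exact: (linearZZ g). Qed.

Lemma lin_sum I (r : seq I) (P : pred I) (F : I -> V) :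
  h (\sum_(i <- r | P i) F i) = \sum_(i <- r | P i) h (F i).
Proof. exact: (linear_sum g). Qed.

End LinearMaps.

(** * Inner products, orthonormal bases and the spectral theorem *)

Section InnerProduct.
Variables (C : numClosedFieldType) (V : lmodType C).
Implicit Types (x y : V) (c : C).

Record inner_product (f : V -> V -> C) : Prop := InnerProduct {
  ip_linear : forall x, linear (f x : V -> C^o);
  ip_conj : forall x y, f y x = (f x y)^*;
  ip_ge0 : forall x, 0 <= f x x;
  ip_def : forall x, f x x = 0 -> x = 0
}.

(** Spanning is stated as an induction principle, which avoids choosing
    coefficients for families that need not be independent. *)
Definition spanned (s : seq V) : Prop :=
  forall P : V -> Prop, P 0 -> (forall c x y, P x -> P y -> P (c *: x + y)) ->
    {in s, forall x, P x} -> forall x, P x.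

Variable f : V -> V -> C.

Definition orthonormal n (e : 'I_n -> V) : Prop :=
  forall i j, f (e i) (e j) = (i == j)%:R.

Definition expands n (e : 'I_n -> V) x : Prop :=
  x = \sum_i f (e i) x *: e i.

Definition orthonormal_basis n (e : 'I_n -> V) : Prop :=
  orthonormal e /\ forall x, expands e x.

Hypothesis ipf : inner_product f.

Lemma ip0r x : f x 0 = 0. Proof. exact: (lin0 (ip_linear ipf x)). Qed.
Lemma ipDr x y z : f x (y + z) = f x y + f x z.
Proof. exact: (linD (ip_linear ipf x)). Qed.
Lemma ipBr x y z : f x (y - z) = f x y - f x z.
Proof. exact: (linB (ip_linear ipf x)). Qed.
Lemma ipZr c x y : f x (c *: y) = c * f x y.
Proof. exact: (linZ (ip_linear ipf x)). Qed.
Lemma ip_sumr x I (r : seq I) (P : pred I) (F : I -> V) :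
  f x (\sum_(i <- r | P i) F i) = \sum_(i <- r | P i) f x (F i).
Proof. exact: (lin_sum (ip_linear ipf x)). Qed.
Lemma ipDl x y z : f (x + y) z = f x z + f y z.
Proof. by rewrite (ip_conj ipf z) ipDr rmorphD /= -!(ip_conj ipf). Qed.
Lemma ipBl x y z : f (x - y) z = f x z - f y z.
Proof. by rewrite (ip_conj ipf z) ipBr rmorphB /= -!(ip_conj ipf). Qed.
Lemma ipZl c x y : f (c *: x) y = c^* * f x y.
Proof. by rewrite (ip_conj ipf y) ipZr rmorphM /= -!(ip_conj ipf). Qed.
Lemma ip_suml x I (r : seq I) (P : pred I) (F : I -> V) :
  f (\sum_(i <- r | P i) F i) x = \sum_(i <- r | P i) f (F i) x.
Proof.
rewrite (ip_conj ipf x) ip_sumr rmorph_sum /=.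
by apply: eq_bigr => i _; rewrite -(ip_conj ipf).
Qed.

Lemma ip_gt0 x : x <> 0 -> 0 < f x x.
Proof.
move=> x0; rewrite lt_neqAle (ip_ge0 ipf) andbT eq_sym.
by apply/eqP => /(ip_def ipf).
Qed.

Lemma ip_ext x y : (forall z, f z x = f z y) -> x = y.
Proof.
by move=> xy; apply/eqP; rewrite -subr_eq0; apply/eqP/(ip_def ipf);
  rewrite ipBr xy subrr.
Qed.

(** Minkowski's inequality for squared norms; the weights a and b stand for
    bounds on the norms of x and y, so that no square root is taken. *)
Lemma ip_minkowski a b k x y : 0 <= a -> 0 <= b ->
  f x x <= a ^+ 2 * k -> f y y <= b ^+ 2 * k ->
  f (x + y) (x + y) <= (a + b) ^+ 2 * k.
Proof.
move=> a0 b0 xk yk.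
have eqD u v : f (u + v) (u + v) = f u u + f v v + (f u v + f v u).
  by rewrite !ipDl !ipDr; ring.
have [a_eq0|/eqP aN0] := a =P 0.
  have -> : x = 0.
    apply: (ip_def ipf); apply/eqP; rewrite eq_le (ip_ge0 ipf) andbT.
    by rewrite (le_trans xk)// a_eq0 expr0n mul0r.
  by rewrite a_eq0 !add0r.
have [b_eq0|/eqP bN0] := b =P 0.
  have -> : y = 0.
    apply: (ip_def ipf); apply/eqP; rewrite eq_le (ip_ge0 ipf) andbT.
    by rewrite (le_trans yk)// b_eq0 expr0n mul0r.
  by rewrite b_eq0 !addr0.
have {}a0 : 0 < a by rewrite lt_neqAle eq_sym aN0.
have {}b0 : 0 < b by rewrite lt_neqAle eq_sym bN0.
have ab0 : 0 < a * b by rewrite mulr_gt0.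
have cross : a * b * (f x y + f y x) <= b ^+ 2 * f x x + a ^+ 2 * f y y.
  have := ip_ge0 ipf (b *: x - a *: y).
  rewrite !ipBl !ipBr !ipZl !ipZr !conj_Creal ?gtr0_real// => H.
  rewrite -subr_ge0; apply: le_trans H _.
  rewrite le_eqVlt; apply/orP; left; apply/eqP.
  ring.
rewrite eqD -(ler_pM2l ab0) mulrDr.
apply: le_trans (lerD (lexx _) cross) _.
have -> : a * b * (f x x + f y y) + (b ^+ 2 * f x x + a ^+ 2 * f y y) =
   (a + b) * (b * f x x + a * f y y).
  ring.
have -> : a * b * ((a + b) ^+ 2 * k) =
   (a + b) * (b * (a ^+ 2 * k) + a * (b ^+ 2 * k)).
  ring.
rewrite ler_pM2l ?addr_gt0//.
by rewrite lerD// ler_pM2l.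
Qed.

Lemma expands_lin n (e : 'I_n -> V) c x y :
  expands e x -> expands e y -> expands e (c *: x + y).
Proof.
rewrite /expands => ex ey; rewrite {1}ex {1}ey scaler_sumr -big_split /=.
by apply: eq_bigr => i _; rewrite ipDr ipZr scalerDl scalerA.
Qed.

(** Gram-Schmidt: each generator is either already in the span of the current
    orthonormal family, or its normalized remainder extends the family. *)
Lemma gram_schmidt s : spanned s ->
  exists n (e : 'I_n -> V), orthonormal_basis e.
Proof.
move=> sP; suff [n [e [eo es]]] : exists n (e : 'I_n -> V),
    orthonormal e /\ {in s, forall x, expands e x}.
  exists n, e; split=> // x; apply: (sP (expands e)) => // [|c u v].
    by rewrite /expands big1// => i _; rewrite ip0r scale0r.
  exact: expands_lin.
elim: s {sP} => [|v s [n [e [eo es]]]].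
  by exists 0%N, (fun=> 0); split=> [[]|].
pose w := v - \sum_i f (e i) v *: e i.
have ew i : f (e i) w = 0.
  rewrite ipBr ip_sumr (bigD1 i)//= big1 ?addr0 => [|j ji].
    by rewrite ipZr eo eqxx mulr1 subrr.
  by rewrite ipZr eo eq_sym (negPf ji) mulr0.
have [w0|/eqP w0] := w =P 0.
  exists n, e; split=> // x; rewrite inE => /orP[/eqP->|/es//].
  by apply/eqP; rewrite -subr_eq0; apply/eqP.
pose k := sqrtC (f w w); pose u := k^-1 *: w.
have ww : 0 < f w w by apply: ip_gt0; apply/eqP.
have k0 : 0 < k by rewrite sqrtC_gt0.
have eu i : f (e i) u = 0 by rewrite ipZr ew mulr0.
have ue i : f u (e i) = 0 by rewrite (ip_conj ipf (e i)) eu rmorph0.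
have uu : f u u = 1.
  rewrite ipZr ipZl conj_Creal ?realV ?gtr0_real// -(sqrtCK (f w w)) -/k.
  by rewrite expr2 mulrA -invfM mulVf// mulf_neq0// gt_eqF.
pose e' (i : 'I_n.+1) := if unlift ord0 i is Some j then e j else u.
exists n.+1, e'; split.
  move=> i j; rewrite /e'.
  by case: unliftP => [i'|] ->; case: unliftP => [j'|] ->;
     rewrite ?eu ?ue ?uu ?eo ?eqxx ?(inj_eq lift_inj)//.
have es' x : expands e x -> expands e' x.
  move=> ex; rewrite /expands big_ord_recl {2}/e' unlift_none.
  have -> : f (e' ord0) x = 0.
    rewrite /e' unlift_none ex ip_sumr big1// => i _.
    by rewrite ipZr ue mulr0.
  by rewrite scale0r add0r [LHS]ex; apply: eq_bigr => i _; rewrite /e' liftK.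
move=> x; rewrite inE => /orP[/eqP->|/es/es'//].
have -> : v = k *: u + (\sum_i f (e i) v *: e i).
  by rewrite scalerA divff ?gt_eqF// scale1r subrK.
apply: expands_lin.
  rewrite /expands big_ord_recl /e' unlift_none uu scale1r big1 ?addr0// => i _.
  by rewrite liftK eu scale0r.
apply: es'; rewrite /expands; apply: eq_bigr => i _; congr (_ *: _).
rewrite ip_sumr (bigD1 i)//= big1 ?addr0 => [|j ji].
  by rewrite ipZr eo eqxx mulr1.
by rewrite ipZr eo eq_sym (negPf ji) mulr0.
Qed.

Lemma parseval n (e : 'I_n -> V) x y : orthonormal_basis e ->
  f x y = \sum_i (f (e i) x)^* * f (e i) y.
Proof.
case=> _ eb; rewrite {1}(eb x) ip_suml.
by apply: eq_bigr => i _; rewrite ipZl.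
Qed.

(** The spectral theorem: the matrix of h in an orthonormal basis is hermitian,
    hence unitarily similar to a diagonal matrix. *)
Lemma self_adjoint_eigenbasis (h : V -> V) n (e : 'I_n -> V) :
  orthonormal_basis e -> linear h -> (forall x y, f (h x) y = f x (h y)) ->
  exists (u : 'I_n -> V) (mu : 'I_n -> C),
    orthonormal_basis u /\ forall i, h (u i) = mu i *: u i.
Proof.
case=> eo eb hl hs.
pose A := \matrix_(i, j) f (e j) (h (e i)).
have Aherm : A \is hermsymmx.
  apply/is_hermitianmxP; rewrite expr0 scale1r; apply/matrixP=> i j.
  by rewrite !mxE -hs (ip_conj ipf (e i)).
have /hermitian_normalmx/orthomx_spectralP AE := Aherm.
set P := spectralmx A in AE; set X := spectral_diag A in AE.
have PU : P \is unitarymx := spectral_unitarymx A.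
have PPt : P *m P ^t* = 1%:M by apply/unitarymxP.
have PtP : P ^t* *m P = 1%:M by apply: mulmx1C.
have PA : P *m A = diag_mx X *m P.
  by rewrite AE !mulmxA mulmxV ?spectral_unit// mul1mx.
pose u i := \sum_j P i j *: e j.
have eu j k : f (e k) (u j) = P j k.
  rewrite ip_sumr (bigD1 k)//= big1 ?addr0 => [|i ik].
    by rewrite ipZr eo eqxx mulr1.
  by rewrite ipZr eo eq_sym (negPf ik) mulr0.
exists u, (fun i => X 0 i); split; first split.
- move=> i j; rewrite (parseval _ _ (conj eo eb)).
  have /matrixP/(_ j i) := PPt; rewrite !mxE eq_sym => <-.
  by apply: eq_bigr => k _; rewrite !eu !mxE mulrC.
- move=> x; rewrite /expands {1}(eb x).
  under [RHS]eq_bigr => i _ do rewrite scaler_sumr.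
  rewrite exchange_big; apply: eq_bigr => j _ /=.
  under eq_bigr => i _ do rewrite scalerA.
  rewrite -scaler_suml; congr (_ *: _).
  have key k : \sum_i (f (e k) (u i))^* * P i j = (k == j)%:R.
    have /matrixP/(_ k j) := PtP; rewrite !mxE => <-.
    by apply: eq_bigr => i _; rewrite eu !mxE.
  under eq_bigr => i _ do rewrite (parseval (u i) x (conj eo eb)) mulr_suml.
  rewrite exchange_big /= (bigD1 j)//= [X in _ + X]big1 => [|k kj].
    rewrite addr0; transitivity ((j == j)%:R * f (e j) x).
      by rewrite eqxx mul1r.
    by rewrite -key mulr_suml; apply: eq_bigr => i _; rewrite mulrAC.
  transitivity ((k == j)%:R * f (e k) x); last by rewrite (negPf kj) mul0r.
  by rewrite -key mulr_suml; apply: eq_bigr => i _; rewrite mulrAC.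
- move=> i; rewrite /u (lin_sum hl) scaler_sumr.
  transitivity (\sum_j (P *m A) i j *: e j).
    under [RHS]eq_bigr => j _ do rewrite mxE scaler_suml.
    rewrite exchange_big; apply: eq_bigr => k _.
    rewrite (linZ hl) [h (e k)]eb scaler_sumr.
    by apply: eq_bigr => j _; rewrite mxE scalerA.
  rewrite PA mul_diag_mx; apply: eq_bigr => j _.
  by rewrite mxE scalerA.
Qed.

(** The operator norm of a positive operator is its largest eigenvalue; the
    alternative k = 0 only accounts for the zero space. *)
Lemma max_eigenvalue (h : V -> V) s :
  spanned s -> linear h -> (forall x y, f (h x) y = f x (h y)) ->
  (forall x, 0 <= f x (h x)) ->
  exists k, [/\ 0 <= k, forall x, f x (h x) <= k * f x x &
    k = 0 \/ exists2 x, x <> 0 & h x = k *: x].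
Proof.
move=> /gram_schmidt[n [e eb]] hl hs h0.
have [u [mu [ub hu]]] := self_adjoint_eigenbasis eb hl hs.
case: n e eb u mu ub hu => [|n] e _ u mu ub hu.
  exists 0; split=> [//|x|]; last by left.
  by rewrite !(parseval _ _ ub) !big_ord0 mul0r.
have mu0 i : 0 <= mu i.
  by have := h0 (u i); rewrite hu ipZr ub.1 eqxx mulr1.
have [|i _ max_i] := @real_arg_maxP _ _ ord0 xpredT mu isT.
  by move=> i _; rewrite ger0_real.
exists (mu i); split=> // [x|]; last first.
  right; exists (u i) => // ui; have := ub.1 i i.
  by rewrite ui ip0r eqxx => /eqP; rewrite eq_sym oner_eq0.
rewrite !(parseval _ _ ub) mulr_sumr; apply: ler_sum => j _.
have -> : f (u j) (h x) = mu j * f (u j) x.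
  by rewrite -hs hu ipZl conj_Creal ?ger0_real.
by rewrite mulrCA; apply: ler_wpM2r; [rewrite mulrC mul_conjC_ge0|exact: max_i].
Qed.

End InnerProduct.

(** * The trace of a finite dimensional C*-algebra *)

Section RealSpectrum.
Variable C : numClosedFieldType.

(** After a unitary triangularization, the squared diagonal entries are squares
    of eigenvalues, and a zero diagonal makes the matrix nilpotent by
    Cayley-Hamilton. *)
Lemma real_spectrum_trace n (A : 'M[C]_n) :
  (forall a, eigenvalue A a -> a \is Num.real) ->
  [/\ \tr A \is Num.real, 0 <= \tr (A *m A) &
    \tr (A *m A) = 0 ->
    exists N, forall v : 'rV_n, iter N (fun w => w *m A) v = 0].
Proof.
case: n A => [|n] A Areal.
  split; rewrite /mxtrace ?big_ord0 ?real0// => _.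
  by exists 0%N => v; rewrite [v]thinmx0.
have [P PU PA] := Schur A (ltn0Sn n).
have Punit := unitarymx_unit PU.
have Btrig : is_trig_mx (P *m A *m invmx P) by rewrite -conjumx.
have [B AB] : exists B, A = invmx P *m B *m P.
  by exists (P *m A *m invmx P); rewrite !mulmxA mulVmx// mul1mx mulmxKV.
have {}Btrig : is_trig_mx B.
  by move: Btrig; rewrite AB !mulmxA mulmxV// mul1mx mulmxK.
have Bdiag i : B i i \is Num.real.
  apply: Areal; have /eigenvalueP[v vB v0] : eigenvalue B (B i i).
    rewrite eigenvalue_root_char char_poly_trig// rootE horner_prod.
    by rewrite (bigD1 i)//= !hornerE subrr mul0r.
  apply/eigenvalueP; exists (v *m P); last first.
    by apply: contraNneq v0 => vP; rewrite -(mulmxK Punit v) vP mul0mx.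
  by rewrite AB !mulmxA mulmxK// vB scalemxAl.
have trA : \tr A = \tr B by rewrite AB mxtrace_mulC mulmxA mulmxV// mul1mx.
have trAA : \tr (A *m A) = \sum_i B i i ^+ 2.
  have -> : A *m A = invmx P *m (B *m B *m P).
    by rewrite {1 2}AB !mulmxA mulmxK.
  rewrite mxtrace_mulC mulmxK//; apply: eq_bigr => i _; rewrite mxE.
  rewrite (bigD1 i)//= big1 ?addr0 // => k ki.
  have /is_trig_mxP Bt := Btrig; case: (ltngtP i k) => [ik|ki'|/val_inj ik].
  - by rewrite Bt ?mul0r.
  - by rewrite (Bt k i) ?mulr0.
  - by rewrite ik eqxx in ki.
have sq0 i : 0 <= B i i ^+ 2 by rewrite real_exprn_even_ge0.
split.
- by rewrite trA; apply: rpred_sum.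
- by rewrite trAA sumr_ge0.
rewrite trAA => /eqP; rewrite psumr_eq0// => /allP B0.
have {}B0 i : B i i = 0.
  by apply/eqP; have := B0 i (mem_index_enum i); rewrite sqrf_eq0.
have iterE k v : iter k (fun w : 'rV_n.+1 => w *m A) v = v *m (A ^+ k).
  elim: k => [|k IHk]; first by rewrite expr0 mulmx1.
  by rewrite exprSr /= IHk -mulmxE mulmxA.
exists n.+1 => v; rewrite iterE.
suff -> : A ^+ n.+1 = 0 by rewrite mulmx0.
have /(congr1 (fun X => invmx P *m X *m P)) : B ^+ n.+1 = 0.
  have := Cayley_Hamilton B; rewrite char_poly_trig//.
  under eq_bigr => i _ do rewrite B0 subr0.
  by rewrite prodr_const card_ord rmorphXn /= horner_mx_X.
have powE k : A ^+ k = invmx P *m B ^+ k *m P.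
  elim: k => [|k IHk]; first by rewrite !expr0 mulmx1 mulVmx.
  by rewrite !exprSr IHk AB -!mulmxE !mulmxA mulmxK.
by rewrite -powE mulmx0 mul0mx.
Qed.

End RealSpectrum.

(** A spanning family with the least number of vectors is free, so coordinates
    along it are unique, hence linear. *)
Lemma linear_coordinates (F : fieldType) (V : lmodType F) n (e : 'I_n -> V) :
  (forall x, exists c : 'I_n -> F, x = \sum_i c i *: e i) ->
  exists m (b : 'I_m -> V) (co : V -> 'rV[F]_m),
    [/\ linear co, forall x, x = \sum_i co x 0 i *: b i &
        forall i, co (b i) = delta_mx 0 i].
Proof.
move=> spe; pose spans m (b : 'I_m -> V) :=
  forall x, exists c : 'I_m -> F, x = \sum_i c i *: b i.
have ex : exists m, `[< exists b : 'I_m -> V, spans m b >].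
  by exists n; apply/asboolP; exists e.
have [m /asboolP[b bs] m_min] := ex_minnP ex.
have free c : \sum_i c i *: b i = 0 -> forall i, c i = 0.
  move=> c0 k; apply/eqP; apply/negPn/negP => ck.
  case: m b bs m_min c k c0 ck => [|m] b bs m_min c k c0 ck; first by case: k ck.
  suff /m_min : `[< exists b : 'I_m -> V, spans m b >] by rewrite ltnn.
  apply/asboolP; exists (fun i => b (lift k i)) => x; have [d ->] := bs x.
  have bk : b k = \sum_i (- (c k)^-1 * c (lift k i)) *: b (lift k i).
    apply: (scalerI ck); rewrite scaler_sumr.
    move: c0; rewrite (bigD1_ord k)//= => /eqP; rewrite addr_eq0 => /eqP->.
    rewrite -sumrN; apply: eq_bigr => i _.
    by rewrite scalerA mulrA mulrN divff// mulN1r scaleNr.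
  exists (fun i => d (lift k i) + d k * (- (c k)^-1 * c (lift k i))).
  rewrite (bigD1_ord k)//= {1}bk scaler_sumr -big_split.
  by apply: eq_bigr => i _ /=; rewrite scalerA addrC -scalerDl.
have uniq_co c d : \sum_i c i *: b i = \sum_i d i *: b i -> c =1 d.
  move=> cd i; apply/eqP; rewrite -subr_eq0; apply/eqP.
  apply: (free (fun i => c i - d i)).
  under eq_bigr => j _ do rewrite scalerBl.
  by rewrite sumrB cd subrr.
pose co x := \row_i sval (cid (bs x)) i.
have coE x : x = \sum_i co x 0 i *: b i.
  rewrite {1}(svalP (cid (bs x))).
  by apply: eq_bigr => i _; rewrite mxE.
exists m, b, co; split=> [k x y||i].
- apply/rowP; apply: uniq_co; rewrite -coE.
  transitivity (\sum_i (k *: (co x 0 i *: b i) + co y 0 i *: b i)).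
    by rewrite big_split -scaler_sumr -!coE.
  by apply: eq_bigr => i _; rewrite !mxE scalerDl scalerA.
- exact: coE.
- apply/rowP; apply: uniq_co; rewrite -coE.
  rewrite (bigD1 i)//= big1 ?addr0 => [|j ji]; first by rewrite mxE !eqxx scale1r.
  by rewrite mxE (negPf ji) andbF scale0r.
Qed.

Section StarLinear.
Variables (R : realType) (A : cstarAlgType R).
Local Notation C := R[i].
Implicit Types (a b x y : A) (c : C).

Lemma cmul_linearl b : linear (fun a => a ** b).
Proof. by move=> c x y; rewrite cmulDl cmulZl. Qed.

Lemma cmul_linearr a : linear (fun b => a ** b).
Proof. by move=> c x y; rewrite cmulDr cmulZr. Qed.

Lemma star0 : star (0 : A) = 0.
Proof. by apply: (addrI (star 0)); rewrite -starD !addr0. Qed.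

Lemma star_sum I (r : seq I) (P : pred I) (F : I -> A) :
  star (\sum_(i <- r | P i) F i) = \sum_(i <- r | P i) star (F i).
Proof. exact: (big_morph _ starD star0). Qed.

Lemma cmul_sumr I (r : seq I) (P : pred I) (F : I -> A) a :
  a ** (\sum_(i <- r | P i) F i) = \sum_(i <- r | P i) a ** F i.
Proof. exact: (lin_sum (cmul_linearr a)). Qed.

(** From a y = c y one gets c (y^* y) = y^* a y = c^* (y^* y), where y^* y is
    nonzero with y. *)
Lemma self_adjoint_eigenvalue_real a c y :
  star a = a -> y <> 0 -> a ** y = c *: y -> c \is Num.real.
Proof.
move=> sa y0 ay; apply/CrealP; apply/eqP; rewrite -subr_eq0; apply/negPn/negP.
move=> cc; apply: y0; apply: star_self0; apply: (scalerI cc).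
rewrite scaler0 scalerBl; apply/eqP; rewrite subr_eq0; apply/eqP.
by rewrite -cmulZl -starZ -ay starM sa -cmulA ay cmulZr.
Qed.

(** If a a y = 0 then (a y)^* (a y) = y^* a a y = 0, so a y = 0: one factor a
    can be removed at a time. *)
Lemma self_adjoint_nilpotent a n :
  star a = a -> (forall y, iter n (cmul a) y = 0) -> a = 0.
Proof.
move=> sa; have sq y : a ** (a ** y) = 0 -> a ** y = 0.
  by move=> aay; apply: star_self0; rewrite starM sa -cmulA aay cmulr0.
elim: n => [/(_ a)//|[_ /(_ a) /= aa|n IHn an]].
  by apply: star_self0; rewrite sa.
by apply: IHn => y; apply: sq; apply: (an y).
Qed.

Record faithful_trace (tau : A -> C) : Prop := FaithfulTrace {
  trace_linear : linear (tau : A -> C^o);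
  trace_star : forall a, tau (star a) = (tau a)^*;
  trace_mulC : forall a b, tau (a ** b) = tau (b ** a);
  trace_ge0 : forall a, 0 <= tau (star a ** a);
  trace_eq0 : forall a, tau (star a ** a) = 0 -> a = 0
}.

(** The trace of left multiplication. Writing a = h + i k with h and k
    self-adjoint, traciality gives tau (star a ** a) = tau (h h) + tau (k k),
    where both terms are sums of squares of real eigenvalues. *)
Lemma faithful_trace_exists : finite_dim A -> exists tau, faithful_trace tau.
Proof.
case=> d [e spe]; have [n [b [co [col coE cob]]]] := linear_coordinates spe.
(* Coordinates are row vectors, so L reverses products. *)
pose L a : 'M[C]_n := \matrix_i co (a ** b i).
have coL a x : co (a ** x) = co x *m L a.
  rewrite [in LHS](coE x) cmul_sumr (lin_sum col) mulmx_sum_row.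
  by apply: eq_bigr => i _; rewrite cmulZr (linZ col) rowK.
have co_inj x y : co x = co y -> x = y.
  by move=> xy; rewrite (coE x) xy -coE.
have co_surj (v : 'rV_n) : v = co (\sum_i v 0 i *: b i).
  rewrite (lin_sum col) {1}[v]row_sum_delta; apply: eq_bigr => i _.
  by rewrite (linZ col) cob.
have Llin : linear L.
  move=> c x y; apply/row_matrixP=> i.
  by rewrite linearD linearZ /= !rowK cmulDl cmulZl col.
have LM x y : L (x ** y) = L y *m L x.
  by apply/row_matrixP=> i; rewrite row_mul !rowK -cmulA coL.
have Leig a c : star a = a -> eigenvalue (L a) c -> c \is Num.real.
  move=> sa /eigenvalueP[v vL v0].
  rewrite [v]co_surj in vL v0; move: vL v0; set z := \sum_i _ => vL v0.
  apply: (@self_adjoint_eigenvalue_real a c z sa).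
    by move=> z0; move: v0; rewrite z0 (lin0 col) eqxx.
  by apply: co_inj; rewrite coL vL (linZ col).
pose tau a := \tr (L a).
have tau_lin : linear (tau : A -> C^o).
  by move=> c x y; rewrite /tau Llin linearP.
have tauC x y : tau (x ** y) = tau (y ** x) by rewrite /tau !LM mxtrace_mulC.
have sa_real a : star a = a -> tau a \is Num.real.
  by move=> sa; have [] := real_spectrum_trace (fun c => @Leig a c sa).
have sa_ge0 a : star a = a -> 0 <= tau (a ** a).
  move=> sa; rewrite /tau LM.
  by have [] := real_spectrum_trace (fun c => @Leig a c sa).
have sa_eq0 a : star a = a -> tau (a ** a) = 0 -> a = 0.
  move=> sa; rewrite /tau LM => aa.
  have [_ _ /(_ aa)[N LN]] := real_spectrum_trace (fun c => @Leig a c sa).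
  apply: (@self_adjoint_nilpotent a N sa) => y; apply: co_inj; rewrite (lin0 col).
  by rewrite -(LN (co y)); elim: N {LN} => //= N <-; rewrite coL.
have two0 : (2 : C) != 0 by rewrite pnatr_eq0.
pose h a := 2^-1 *: (a + star a); pose k a := ('i / 2) *: (star a - a).
have sh a : star (h a) = h a.
  by rewrite /h starZ starD starK addrC rmorphV ?unitfE//= conjC_nat.
have starN a : star (- a) = - star a.
  by rewrite -scaleN1r starZ rmorphN1 scaleN1r.
have sk a : star (k a) = k a.
  rewrite /k starZ starD starK starN rmorphM rmorphV ?unitfE//= conjC_nat conjCi.
  by rewrite mulNr scaleNr -scalerN opprB.
have hk a : a = h a + 'i *: k a.
  rewrite /h /k scalerA mulrA -expr2 sqrCi mulN1r scaleNr -scalerBr.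
  suff -> : a + star a - (star a - a) = 2 *: a
    by rewrite scalerA mulVf// scale1r.
  by rewrite opprB addrC addrA addrAC subrK scaler_nat mulr2n.
have tauD x y : tau (x + y) = tau x + tau y := linD tau_lin x y.
have tauZ c x : tau (c *: x) = c * tau x := linZ tau_lin c x.
have star_a a : star a = h a - 'i *: k a.
  by rewrite {1}(hk a) starD sh starZ sk conjCi scaleNr.
have tau_ss a : tau (star a ** a) = tau (h a ** h a) + tau (k a ** k a).
  rewrite star_a {3}(hk a) -scaleNr; move: (h a) (k a) => x y.
  rewrite cmulDl !cmulDr !cmulZl !cmulZr !tauD !tauZ (tauC y x).
  by ring: (sqrCi C).
exists tau; split=> // [a|a|a].
- rewrite star_a {3}(hk a) -scaleNr.
  have := sa_real _ (sh a); have := sa_real _ (sk a).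
  move: (h a) (k a) => x y yr xr.
  by rewrite !tauD !tauZ rmorphD rmorphM /= conjCi !conj_Creal.
- by rewrite tau_ss addr_ge0// sa_ge0.
- rewrite tau_ss => /eqP; rewrite paddr_eq0 ?sa_ge0// => /andP[/eqP h0 /eqP k0].
  by rewrite (hk a) (sa_eq0 _ _ h0)// (sa_eq0 _ _ k0)// scaler0 addr0.
Qed.

End StarLinear.

(** * Orthonormal bases and units *)

Section TraceBasis.
Variables (R : realType) (A : cstarAlgType R).
Local Notation C := R[i].
Implicit Types (a b x y : A) (c : C) (tau : A -> C).

Definition trace_form tau x y : C := tau (star x ** y).

Lemma trace_form_inner tau :
  faithful_trace tau -> inner_product (trace_form tau).
Proof.
move=> ft; split=> [x c y z|x y|x|x].
- by rewrite /trace_form cmulDr cmulZr (trace_linear ft).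
- by rewrite /trace_form -(trace_star ft) starM starK.
- exact: trace_ge0.
- exact: trace_eq0.
Qed.

(** The trace itself is the inner product with some vector; its adjoint is a
    unit, because tau (u ** x ** y) = tau (x ** y) for all x and y. *)
Lemma trace_unit tau n (e : 'I_n -> A) : faithful_trace tau ->
  orthonormal_basis (trace_form tau) e -> exists u : A, is_unit u.
Proof.
move=> ft [eo eb]; have ip := trace_form_inner ft.
pose u := star (\sum_i (tau (e i))^* *: e i).
have tau_u x : tau (u ** x) = tau x.
  rewrite -/(trace_form tau _ x) (parseval ip _ _ (conj eo eb)) [in RHS](eb x).
  rewrite (lin_sum (trace_linear ft)); apply: eq_bigr => i _.
  rewrite (linZ (trace_linear ft)) [RHS]mulrC; congr (_ * _).
  rewrite (ip_sumr ip) (bigD1 i)//= big1 ?addr0 => [|j ji].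
    by rewrite (ipZr ip) eo eqxx mulr1 conjCK.
  by rewrite (ipZr ip) eo eq_sym (negPf ji) mulr0.
have tau_ext x y : (forall z, tau (x ** z) = tau (y ** z)) -> x = y.
  move=> xy; apply: (can_inj (@starK R A)); apply: (ip_ext ip) => z.
  rewrite /trace_form -!starM !(trace_star ft) ![tau (_ ** z)](trace_mulC ft).
  by rewrite ![tau (z ** _)](trace_mulC ft) xy.
exists u => a; split; apply: tau_ext => z.
  by rewrite -cmulA tau_u.
by rewrite -cmulA (trace_mulC ft) -cmulA tau_u (trace_mulC ft).
Qed.

Record trace_basis := TraceBasis {
  tr : A -> C;
  dim : nat;
  basis : 'I_dim -> A;
  one : A;
  trP : faithful_trace tr;
  basisP : orthonormal_basis (trace_form tr) basis;
  oneP : is_unit one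
}.

Lemma trace_basis_exists : finite_dim A -> inhabited trace_basis.
Proof.
move=> fd; have [tau ft] := faithful_trace_exists fd.
have [d [e spe]] := fd.
have [|n [u ub]] := gram_schmidt (trace_form_inner ft) (s := codom e).
  move=> P P0 Plin Pe x; have [c ->] := spe x.
  elim/big_rec: _ => // i y _ Py; apply: Plin => //.
  by apply: Pe; exact: codom_f.
have [o oP] := trace_unit ft ub.
by exists; apply: (@TraceBasis tau n u o).
Qed.

End TraceBasis.
Arguments basis {R A} t i : rename.

(** * The tensor product of two finite dimensional C*-algebras *)

(** The tensor product A (x) B, an element being the family of its left
    coefficients along the chosen orthonormal basis of B. The basis of A is a
    parameter because the norm given to this space is built from it. *)
Definition tensor (R : realType) (A B : cstarAlgType R)
    (alpha : trace_basis A) (beta : trace_basis B) : Type :=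
  {ffun 'I_(dim beta) -> A}.

Section Tensor.
Variables (R : realType) (A B : cstarAlgType R).
Variables (alpha : trace_basis A) (beta : trace_basis B).
Local Notation C := R[i].
Local Notation e := (basis beta).
Local Notation coord := (trace_form (tr beta)).
Local Notation tensor := (tensor alpha beta).

HB.instance Definition _ := GRing.Lmodule.on tensor.

Implicit Types (x y z : tensor) (a : A) (b : B) (c : C).

Definition elt a b : tensor := [ffun i => coord (e i) b *: a].
Definition tmul x y : tensor :=
  \sum_i \sum_j elt (x i ** y j) (e i ** e j).
Definition tstar x : tensor := \sum_i elt (star (x i)) (star (e i)).
Definition ttrace x : C := \sum_i tr alpha (x i) * tr beta (e i).

Let ipb := trace_form_inner (trP beta).
Let ipa := trace_form_inner (trP alpha).

Lemma tensD x y i : (x + y) i = x i + y i. Proof. by rewrite ffunE. Qed.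
Lemma tensZ c x i : (c *: x) i = c *: x i. Proof. by rewrite ffunE. Qed.

Lemma elt_linearl b : linear (elt^~ b).
Proof.
move=> c a a'; apply/ffunP=> i; rewrite !ffunE.
by rewrite scalerDr !scalerA mulrC.
Qed.

Lemma elt_linearr a : linear (elt a).
Proof.
move=> c b b'; apply/ffunP=> i; rewrite !ffunE.
by rewrite (ip_linear ipb) scalerDl scalerA.
Qed.

Lemma tens_decomp x : x = \sum_i elt (x i) (e i).
Proof.
apply/ffunP=> i; rewrite sum_ffunE (bigD1 i)//= big1 ?addr0 => [|j ji].
  by rewrite ffunE (basisP beta).1 eqxx scale1r.
by rewrite ffunE (basisP beta).1 eq_sym (negPf ji) scale0r.
Qed.

Lemma tens_ind (P : tensor -> Prop) :
  P 0 -> (forall x y, P x -> P y -> P (x + y)) -> (forall a b, P (elt a b)) ->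
  forall x, P x.
Proof.
by move=> P0 PD Pe x; rewrite (tens_decomp x); apply: (big_ind P) => // i _.
Qed.

(** The vector b is the sum of its components along the basis, and F is
    bilinear. The operations on tensors are defined by such sums over the
    basis, which are thus evaluated on elementary tensors. *)
Lemma elt_sum (W : lmodType C) (F : A -> B -> W) a b :
  (forall b, linear (F^~ b)) -> (forall a, linear (F a)) ->
  \sum_i F (elt a b i) (e i) = F a b.
Proof.
move=> Fl Fr; rewrite [in RHS]((basisP beta).2 b) (lin_sum (Fr a)).
by apply: eq_bigr => i _; rewrite ffunE (linZ (Fl _)) (linZ (Fr _)).
Qed.

Lemma tmul_linearl y : linear (tmul^~ y).
Proof.
move=> c x z; rewrite /tmul scaler_sumr -big_split; apply: eq_bigr => i _ /=.
rewrite scaler_sumr -big_split; apply: eq_bigr => j _ /=.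
by rewrite !ffunE cmulDl cmulZl elt_linearl.
Qed.

Lemma tmul_linearr x : linear (tmul x).
Proof.
move=> c y z; rewrite /tmul scaler_sumr -big_split; apply: eq_bigr => i _ /=.
rewrite scaler_sumr -big_split; apply: eq_bigr => j _ /=.
by rewrite !ffunE cmulDr cmulZr elt_linearl.
Qed.

Lemma tmul_elt a b a' b' : tmul (elt a b) (elt a' b') = elt (a ** a') (b ** b').
Proof.
rewrite /tmul.
have sumj a1 b1 : \sum_j elt (a1 ** elt a' b' j) (b1 ** e j)
    = elt (a1 ** a') (b1 ** b').
  apply: (elt_sum (F := fun a2 b2 => elt (a1 ** a2) (b1 ** b2))) => [b2|a2] c u v.
    by rewrite cmulDr cmulZr elt_linearl.
  by rewrite cmulDr cmulZr elt_linearr.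
under eq_bigr => i _ do rewrite sumj.
apply: (elt_sum (F := fun a1 b1 => elt (a1 ** a') (b1 ** b'))) => [b1|a1] c u v.
  by rewrite cmulDl cmulZl elt_linearl.
by rewrite cmulDl cmulZl elt_linearr.
Qed.

Lemma tmulDl : left_distributive tmul +%R.
Proof. by move=> x y z; rewrite (linD (tmul_linearl z)). Qed.
Lemma tmulDr : right_distributive tmul +%R.
Proof. by move=> x y z; rewrite (linD (tmul_linearr x)). Qed.
Lemma tmul0l x : tmul 0 x = 0. Proof. exact: (lin0 (tmul_linearl x)). Qed.
Lemma tmul0r x : tmul x 0 = 0. Proof. exact: (lin0 (tmul_linearr x)). Qed.
Lemma tmulZl c x y : tmul (c *: x) y = c *: tmul x y.
Proof. exact: (linZ (tmul_linearl y)). Qed.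
Lemma tmulZr c x y : tmul x (c *: y) = c *: tmul x y.
Proof. exact: (linZ (tmul_linearr x)). Qed.

Lemma tmulA : associative tmul.
Proof.
move=> x y z; elim/tens_ind: x => [|x x' IH IH'|a b].
- by rewrite !tmul0l.
- by rewrite !tmulDl IH IH'.
elim/tens_ind: y => [|y y' IH IH'|a' b'].
- by rewrite tmul0r !tmul0l tmul0r.
- by rewrite !tmulDl !tmulDr tmulDl IH IH'.
elim/tens_ind: z => [|z z' IH IH'|a'' b''].
- by rewrite !tmul0r.
- by rewrite !tmulDr IH IH'.
by rewrite !tmul_elt !cmulA.
Qed.

Lemma tstarD : {morph tstar : x y / x + y}.
Proof.
move=> x y; rewrite /tstar -big_split; apply: eq_bigr => i _ /=.
by rewrite tensD starD (linD (elt_linearl _)).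
Qed.

Lemma tstarZ c x : tstar (c *: x) = c^* *: tstar x.
Proof.
rewrite /tstar scaler_sumr; apply: eq_bigr => i _ /=.
by rewrite tensZ starZ (linZ (elt_linearl _)).
Qed.

Lemma tstar0 : tstar 0 = 0.
Proof. by apply: (addrI (tstar 0)); rewrite -tstarD !addr0. Qed.

Lemma tstar_elt a b : tstar (elt a b) = elt (star a) (star b).
Proof.
rewrite /tstar; transitivity
    (\sum_i elt (star a) (star (coord (e i) b *: e i))).
  apply: eq_bigr => i _; rewrite ffunE !starZ.
  by rewrite (linZ (elt_linearl _)) (linZ (elt_linearr _)).
by rewrite -(lin_sum (elt_linearr _)) -star_sum -((basisP beta).2 b).
Qed.

Lemma tstarM x y : tstar (tmul x y) = tmul (tstar y) (tstar x).
Proof.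
elim/tens_ind: x => [|x x' IH IH'|a b].
- by rewrite tmul0l tstar0 tmul0r.
- by rewrite tmulDl !tstarD tmulDr IH IH'.
elim/tens_ind: y => [|y y' IH IH'|a' b'].
- by rewrite tmul0r tstar0 tmul0l.
- by rewrite tmulDr !tstarD tmulDl IH IH'.
by rewrite !(tmul_elt, tstar_elt) !starM.
Qed.

Lemma tstarK : involutive tstar.
Proof.
elim/tens_ind => [|x x' IH IH'|a b].
- by rewrite !tstar0.
- by rewrite !tstarD IH IH'.
by rewrite !tstar_elt !starK.
Qed.

Lemma ttrace_linear : linear (ttrace : tensor -> C^o).
Proof.
move=> c x y; rewrite /ttrace scaler_sumr -big_split; apply: eq_bigr => i _ /=.
rewrite tensD tensZ (trace_linear (trP alpha)).
by rewrite mulrDl -mulrA.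
Qed.

Lemma ttrace_elt a b : ttrace (elt a b) = tr alpha a * tr beta b.
Proof.
apply: (elt_sum (W := C^o) (F := fun a b => tr alpha a * tr beta b))
  => [b'|a'] c u v.
  by rewrite (trace_linear (trP alpha)) mulrDl -mulrA.
by rewrite (trace_linear (trP beta)) mulrDr mulrCA.
Qed.

Definition tform x y : C := ttrace (tmul (tstar x) y).

Lemma tform_elt a b a' b' :
  tform (elt a b) (elt a' b')
  = trace_form (tr alpha) a a' * trace_form (tr beta) b b'.
Proof. by rewrite /tform tstar_elt tmul_elt ttrace_elt. Qed.

Lemma tform_linear x : linear (tform x : tensor -> C^o).
Proof. by move=> c y z; rewrite /tform tmul_linearr ttrace_linear. Qed.

(** As the basis of B is orthonormal, A (x) B is the orthogonal sum of copies
    of A; positivity of the form follows. *)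
Lemma tformE x y : tform x y = \sum_i trace_form (tr alpha) (x i) (y i).
Proof.
have tf0 z : tform 0 z = 0.
  by rewrite /tform tstar0 tmul0l (lin0 ttrace_linear).
have tfD u v z : tform (u + v) z = tform u z + tform v z.
  by rewrite /tform tstarD tmulDl (linD ttrace_linear).
rewrite {1}(tens_decomp x).
rewrite (big_morph (tform^~ y) (fun u v => tfD u v y) (tf0 y)).
apply: eq_bigr => i _; rewrite {1}(tens_decomp y) (lin_sum (tform_linear _)).
rewrite (bigD1 i)//= big1 ?addr0 => [|j ji].
  by rewrite tform_elt (basisP beta).1 eqxx mulr1.
by rewrite tform_elt (basisP beta).1 eq_sym (negPf ji) mulr0.
Qed.

Lemma tform_inner : inner_product tform.
Proof.
split=> [|x y|x|x]; first exact: tform_linear.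
- rewrite !tformE rmorph_sum; apply: eq_bigr => i _.
  exact: (ip_conj ipa).
- by rewrite tformE sumr_ge0// => i _; apply: (ip_ge0 ipa).
- rewrite tformE => /eqP; rewrite psumr_eq0 => [/allP x0|i _].
    apply/ffunP=> i; rewrite ffunE; apply: (ip_def ipa); apply/eqP.
    by have := x0 i (mem_index_enum i).
  exact: (ip_ge0 ipa).
Qed.

Lemma tform_adj x y z : tform (tmul x y) z = tform y (tmul (tstar x) z).
Proof. by rewrite /tform tstarM tmulA. Qed.

Lemma tens_spanned :
  spanned (codom (fun p : 'I_(dim alpha) * 'I_(dim beta) =>
    elt (basis alpha p.1) (e p.2))).
Proof.
move=> P P0 Plin Pe; elim/tens_ind => // [x y Px Py|a b].
  by rewrite -[x]scale1r; apply: Plin.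
have PD x y : P x -> P y -> P (x + y).
  by move=> Px Py; rewrite -[x]scale1r; apply: Plin.
have PZ c x : P x -> P (c *: x).
  by move=> Px; rewrite -[_ *: x]addr0; apply: Plin.
rewrite ((basisP beta).2 b) (lin_sum (elt_linearr a)).
apply: (big_ind P) => // j _; rewrite (linZ (elt_linearr a)); apply: (PZ).
rewrite ((basisP alpha).2 a) (lin_sum (elt_linearl (e j))).
apply: (big_ind P) => // i _; rewrite (linZ (elt_linearl (e j))); apply: (PZ).
by apply: Pe; apply/codomP; exists (i, j).
Qed.

End Tensor.

(** * The C*-norm of the tensor product *)

Lemma is_unit_star (R : realType) (A : cstarAlgType R) (u : A) :
  is_unit u -> star u = u.
Proof.
move=> uP; have uu : star u ** u = star u by exact: (uP _).2.
by rewrite -[RHS]starK -[in RHS]uu starM starK uu.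
Qed.

Section TensorNorm.
Variables (R : realType) (A B : cstarAlgType R).
Variables (alpha : trace_basis A) (beta : trace_basis B).
Local Notation C := R[i].
Local Notation e := (basis beta).
Local Notation tensor := (tensor alpha beta).
Implicit Types (x y z : tensor) (a : A) (b : B) (c : C).

Let ip : inner_product (@tform _ _ _ alpha beta) := tform_inner alpha beta.

Definition tunit : tensor := elt alpha beta (one alpha) (one beta).

Lemma tmul1l x : tmul tunit x = x.
Proof.
elim/tens_ind: x => [|x y IHx IHy|a b]; rewrite ?tmul0r ?tmulDr ?IHx ?IHy//.
by rewrite tmul_elt (oneP alpha a).1 (oneP beta b).1.
Qed.

Lemma tmul1r x : tmul x tunit = x.
Proof.
elim/tens_ind: x => [|x y IHx IHy|a b]; rewrite ?tmul0l ?tmulDl ?IHx ?IHy//.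
by rewrite tmul_elt (oneP alpha a).2 (oneP beta b).2.
Qed.

(** The operator norm of left multiplication by x. Its square is an eigenvalue
    of left multiplication by star x ** x, and an eigenvector is an element of
    the algebra: this is how the norm is compared with other norms. *)
Lemma tnorm_spec x : exists k, [/\ 0 <= k,
  forall y, tform (tmul x y) (tmul x y) <= k ^+ 2 * tform y y &
  k = 0 \/ exists2 y, y <> 0 & tmul (tstar x) (tmul x y) = k ^+ 2 *: y].
Proof.
have [|y z|y|k [k0 hk eig]] := max_eigenvalue ip
  (h := fun y => tmul (tstar x) (tmul x y)) (@tens_spanned _ _ _ alpha beta).
- by move=> c y z; rewrite !tmul_linearr.
- by rewrite [LHS]tform_adj tstarK [LHS]tform_adj.
- by rewrite -tform_adj (ip_ge0 ip).
exists (sqrtC k); rewrite sqrtCK; split.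
- by rewrite sqrtC_ge0.
- by move=> y; rewrite tform_adj.
- by case: eig => [->|]; [left; rewrite sqrtC0|right].
Qed.

Definition tnorm x : C := sval (cid (tnorm_spec x)).

Lemma tnorm_ge0 x : 0 <= tnorm x.
Proof. by rewrite /tnorm; case: cid => k []. Qed.

Lemma tnorm_bound x y :
  tform (tmul x y) (tmul x y) <= tnorm x ^+ 2 * tform y y.
Proof. by rewrite /tnorm; case: cid => k []. Qed.

Lemma tnorm_eigen x : tnorm x = 0 \/
  exists2 y, y <> 0 & tmul (tstar x) (tmul x y) = tnorm x ^+ 2 *: y.
Proof. by rewrite /tnorm; case: cid => k []. Qed.

Lemma tnorm_le x k : 0 <= k ->
  (forall y, tform (tmul x y) (tmul x y) <= k ^+ 2 * tform y y) -> tnorm x <= k.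
Proof.
move=> k0 xk; have [->//|[y y0 xy]] := tnorm_eigen x.
rewrite -(@ler_pXn2r _ 2)// ?nnegrE ?tnorm_ge0//.
rewrite -(ler_pM2r (ip_gt0 ip y0)); apply: le_trans (xk y).
by rewrite tform_adj xy (ipZr ip).
Qed.

Lemma tnormD x y : tnorm (x + y) <= tnorm x + tnorm y.
Proof.
apply: tnorm_le => [|z]; first by rewrite addr_ge0 ?tnorm_ge0.
by rewrite tmulDl; apply: (ip_minkowski ip); rewrite ?tnorm_ge0 ?tnorm_bound.
Qed.

Lemma tnormZ c x : tnorm (c *: x) = `|c| * tnorm x.
Proof.
have le d y : tnorm (d *: y) <= `|d| * tnorm y.
  apply: tnorm_le => [|z]; first by rewrite mulr_ge0 ?tnorm_ge0.
  rewrite tmulZl (ipZl ip) (ipZr ip) mulrA [d^* * d]mulrC -normCK exprMn.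
  rewrite -[leRHS]mulrA.
  by rewrite ler_wpM2l ?exprn_ge0 ?tnorm_bound.
apply/eqP; rewrite eq_le le /=.
have [->|c0] := eqVneq c 0; first by rewrite normr0 mul0r tnorm_ge0.
rewrite -ler_pdivlMl ?normr_gt0// -normfV.
by rewrite -{1}[x]scale1r -(mulVf c0) -scalerA le.
Qed.

Lemma tnorm_eq0 x : tnorm x = 0 -> x = 0.
Proof.
move=> x0; have := tnorm_bound x tunit; rewrite x0 expr0n mul0r tmul1r => xx.
by apply: (ip_def ip); apply/eqP; rewrite eq_le xx (ip_ge0 ip).
Qed.

Lemma tnormM x y : tnorm (tmul x y) <= tnorm x * tnorm y.
Proof.
apply: tnorm_le => [|z]; first by rewrite mulr_ge0 ?tnorm_ge0.
rewrite -tmulA exprMn -mulrA (le_trans (tnorm_bound _ _))//.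
by rewrite ler_wpM2l ?exprn_ge0 ?tnorm_ge0 ?tnorm_bound.
Qed.

(** If x (x^* y) = |x^*|^2 y, then w = x^* y satisfies
    |x w| = |x^*| |w| up to the case w = 0. *)
Lemma tnorm_star_le x : tnorm (tstar x) <= tnorm x.
Proof.
have [->|[y y0]] := tnorm_eigen (tstar x); first exact: tnorm_ge0.
rewrite tstarK; set n := tnorm _ => xxy; set w := tmul (tstar x) y in xxy.
have [->|/eqP n0] := n =P 0; first exact: tnorm_ge0.
have w0 : w <> 0.
  move=> w0; move: xxy; rewrite w0 tmul0r => /esym/eqP.
  by rewrite scaler_eq0 sqrf_eq0 (negPf n0) => /eqP.
have nn : 0 <= n by exact: tnorm_ge0.
rewrite -(@ler_pXn2r _ 2)// ?nnegrE ?tnorm_ge0//.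
rewrite -(ler_pM2r (ip_gt0 ip w0)); apply: le_trans (tnorm_bound x w).
by rewrite tform_adj xxy tmulZr (ipZr ip).
Qed.

Lemma tnorm_cstar x : tnorm (tmul (tstar x) x) = tnorm x ^+ 2.
Proof.
apply/eqP; rewrite eq_le; apply/andP; split.
  by rewrite (le_trans (tnormM _ _))// expr2 ler_wpM2r ?tnorm_ge0 ?tnorm_star_le.
have [->|[y y0 xy]] := tnorm_eigen x; first by rewrite expr0n tnorm_ge0.
rewrite -(@ler_pXn2r _ 2)// ?nnegrE ?exprn_ge0 ?tnorm_ge0//.
rewrite -(ler_pM2r (ip_gt0 ip y0)).
apply: le_trans (tnorm_bound (tmul (tstar x) x) y).
rewrite -tmulA xy (ipZl ip) (ipZr ip) mulrA.
by rewrite conj_Creal ?ger0_real ?exprn_ge0 ?tnorm_ge0// -expr2.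
Qed.

HB.instance Definition _ :=
  Lmodule_isNormed.Build C tensor tnormD tnormZ tnorm_eq0.

Lemma tnormE x : `|x| = tnorm x. Proof. by []. Qed.

Lemma tmul_left a y i :
  tmul (elt alpha beta a (one beta)) y i = a ** y i.
Proof.
elim/tens_ind: y => [|y z IHy IHz|a' b'].
- by rewrite tmul0r !ffunE cmulr0.
- by rewrite tmulDr !tensD IHy IHz cmulDr.
by rewrite tmul_elt (oneP beta b').1 !ffunE cmulZr.
Qed.

(** For b = 1, an eigenvector y of star a ** a (x) 1 has a nonzero
    coefficient, which is an eigenvector of star a ** a in A; so the square of
    the norm of a (x) 1 is at most |star a ** a| = |a|^2. *)
Lemma norm_elt_le a b :
  `|elt alpha beta a b| <= `|a| * `|elt alpha beta (one alpha) b|.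
Proof.
have -> : elt alpha beta a b =
    tmul (elt alpha beta a (one beta)) (elt alpha beta (one alpha) b).
  by rewrite tmul_elt (oneP alpha a).2 (oneP beta b).1.
rewrite (le_trans (tnormM _ _))// ler_wpM2r ?tnorm_ge0//.
set u := elt _ _ a _; have [->//|[y y0]] := tnorm_eigen u.
rewrite tmulA tstar_elt tmul_elt.
have -> : star (one beta) ** one beta = one beta.
  by rewrite (oneP beta _).2; apply: is_unit_star; exact: oneP.
move=> uy; have [i yi] : exists i, y i != 0.
  apply: contrapT => /forallNP y_eq0; apply: y0; apply/ffunP=> i.
  by rewrite ffunE; apply/eqP/negPn/negP/y_eq0.
have /ffunP/(_ i) := uy; rewrite tmul_left tensZ => /(congr1 Num.norm).
rewrite normrZ => uyi.
rewrite -(@ler_pXn2r _ 2)// ?nnegrE ?tnorm_ge0//.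
rewrite -[leLHS]ger0_norm ?exprn_ge0 ?tnorm_ge0//.
have yi0 : 0 < `|y i| by rewrite normr_gt0.
by rewrite -(ler_pM2r yi0) -uyi -cstar_norm cmul_norm.
Qed.

(** The norm of A is bounded by the Hilbert norm through an orthonormal basis,
    and the Hilbert norm of x = x ** 1 by |x| times the Hilbert norm of 1. *)
Definition coef_bound : C :=
  sqrtC (tform tunit tunit) * (\sum_j `|basis alpha j|).

Lemma norm_coef_le x i : `|x i| <= coef_bound * `|x|.
Proof.
have xi j : `|trace_form (tr alpha) (basis alpha j) (x i)|
    <= sqrtC (tform tunit tunit) * `|x|.
  rewrite -(@ler_pXn2r _ 2)// ?nnegrE ?mulr_ge0 ?sqrtC_ge0 ?(ip_ge0 ip)//.
  rewrite exprMn sqrtCK mulrC.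
  apply: le_trans (tnorm_bound x tunit); rewrite tmul1r tformE.
  rewrite (bigD1 i)//= ler_wpDr ?sumr_ge0// => [k _|].
    exact: (ip_ge0 (trace_form_inner (trP alpha))).
  rewrite (parseval (trace_form_inner (trP alpha)) (x i) (x i) (basisP alpha)).
  rewrite (bigD1 j)//= normCK mulrC ler_wpDr ?sumr_ge0// => k _.
  by rewrite mulrC mul_conjC_ge0.
rewrite {1}((basisP alpha).2 (x i)) (le_trans (ler_norm_sum _ _ _))//.
rewrite /coef_bound mulrAC mulr_sumr; apply: ler_sum => j _.
by rewrite normrZ ler_wpM2r.
Qed.

(** Convergence is coefficientwise, so completeness is inherited from A. *)
Lemma tensor_complete (F : set_system tensor) :
  ProperFilter F -> cauchy F -> cvg F.
Proof.
move=> PF /cauchyP Fc.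
have bound0 : 0 < coef_bound + 1.
  rewrite ltr_wpDl// mulr_ge0 ?sqrtC_ge0 ?(ip_ge0 ip)//.
  by rewrite sumr_ge0.
have coef_cvg i : cvg ((fun x : tensor => x i) @ F).
  apply: cauchy_cvg; apply/cauchyP => eps eps0.
  have [x Fx] := Fc (eps / (coef_bound + 1)) (divr_gt0 eps0 bound0).
  exists (x i).
  suff sub : ball x (eps / (coef_bound + 1))
      `<=` [set y : tensor | ball (x i) eps (y i)] by exact: filterS sub Fx.
  move=> y; rewrite -!ball_normE /= ltr_pdivlMr// => xy.
  have -> : x i - y i = (x - y) i by rewrite !ffunE.
  apply: le_lt_trans (norm_coef_le _ _) _; apply: le_lt_trans xy.
  by rewrite mulrC ler_wpM2l// lerDl.
pose l : tensor := [ffun i => lim ((fun x : tensor => x i) @ F)].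
apply/cvg_ex; exists l; apply/cvgrPdist_lt => eps eps0.
pose K : C := \sum_i `|elt alpha beta (one alpha) (e i)| + 1.
have K0 : 0 < K by rewrite ltr_wpDl// sumr_ge0.
have near_l : F [set x : tensor | forall i, `|l i - x i| < eps / K].
  apply: (@filter_forall _ _ (fun i (x : tensor) => `|l i - x i| < eps / K)).
  move=> i; rewrite /l ffunE.
  by have /cvgrPdist_lt := coef_cvg i; apply; apply: divr_gt0.
apply: filterS near_l => x lx.
rewrite (tens_decomp (l - x)) (le_lt_trans (ler_norm_sum _ _ _))//.
apply: (@le_lt_trans _ _
  (\sum_i eps / K * `|elt alpha beta (one alpha) (e i)|)).
  apply: ler_sum => i _; rewrite (le_trans (norm_elt_le _ _))//.
  have -> : (l - x) i = l i - x i by rewrite !ffunE.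
  by rewrite ler_wpM2r// ltW.
rewrite -mulr_sumr mulrAC ltr_pdivrMr// ltr_pM2l//.
by rewrite /K ltrDl.
Qed.

HB.instance Definition _ := Uniform_isComplete.Build tensor tensor_complete.

HB.instance Definition _ :=
  isCStarAlgebra.Build R tensor (@tmulA _ _ _ alpha beta)
    (@tmulDl _ _ _ alpha beta)
    (@tmulDr _ _ _ alpha beta)
    (@tmulZl _ _ _ alpha beta) (fun c x y => tmulZr c x y)
    (@tstarD _ _ _ alpha beta) (@tstarZ _ _ _ alpha beta)
    (@tstarM _ _ _ alpha beta) (@tstarK _ _ _ alpha beta)
    tnormM tnorm_cstar.

End TensorNorm.

(** * Minimality and ergodicity *)

Section MinimalTensor.
Variables (R : realType) (A B : cstarAlgType R).
Variables (alpha : trace_basis A) (beta : trace_basis B).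
Local Notation C := R[i].
Local Notation e := (basis beta).
Local Notation tensor := (tensor alpha beta : cstarAlgType R).

Lemma basis_lin_indep (D : cstarAlgType R) (delta : trace_basis D) :
  lin_indep (basis delta).
Proof.
move=> c c0 i; have ip := trace_form_inner (trP delta).
rewrite -(ip0r ip (basis delta i)) -c0 (ip_sumr ip).
rewrite (bigD1 i)//= big1 ?addr0 => [|j ji].
  by rewrite (ipZr ip) (basisP delta).1 eqxx mulr1.
by rewrite (ipZr ip) (basisP delta).1 eq_sym (negPf ji) mulr0.
Qed.

Lemma elt_tensor_embedding :
  is_tensor_embedding (elt alpha beta : A -> B -> tensor).
Proof.
split=> [b|a|a a' b b'|a b|n a b b_indep ab0 i].
- exact: elt_linearl.
- exact: elt_linearr.
- by rewrite [RHS]tmul_elt.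
- by rewrite [RHS]tstar_elt.
have ipa := trace_form_inner (trP alpha).
have ipb := trace_form_inner (trP beta).
suff ai k : trace_form (tr alpha) (basis alpha k) (a i) = 0.
  by rewrite ((basisP alpha).2 (a i)) big1// => k _; rewrite ai scale0r.
apply: (b_indep (fun i => trace_form (tr alpha) (basis alpha k) (a i))).
apply: (ip_ext ipb) => z; rewrite (ip0r ipb).
rewrite [z](basisP beta).2 (ip_suml ipb) big1// => j _; rewrite (ipZl ipb).
have /ffunP/(_ j) := ab0; rewrite sum_ffunE ffunE => abj.
rewrite (_ : trace_form _ (e j) (\sum_i0 _) = 0) ?mulr0//.
rewrite (ip_sumr ipb) -[RHS](ip0r ipa (basis alpha k)) -abj (ip_sumr ipa).
by apply: eq_bigr => l _; rewrite (ipZr ipb) ffunE (ipZr ipa) mulrC.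
Qed.

Lemma tens_sum_surj (x : tensor) :
  exists s, tens_sum (elt alpha beta : A -> B -> tensor) s = x.
Proof.
exists [seq (x i, e i) | i <- index_enum 'I_(dim beta)].
by rewrite /tens_sum big_map -tens_decomp.
Qed.

(** An injective homomorphism theta to any C*-algebra does not decrease norms:
    theta maps the eigenvector of star x ** x for the eigenvalue |x|^2 to an
    eigenvector of theta (star x ** x), whose norm thus is at least |x|^2. *)
Lemma tnorm_min (S : cstarAlgType R) (t : A -> B -> S) :
  is_tensor_embedding t ->
  forall s,
    `|tens_sum (elt alpha beta : A -> B -> tensor) s| <= `|tens_sum t s|.
Proof.
move=> te s; pose theta (x : tensor) : S := \sum_i t (x i) (e i).
have theta_lin : linear theta.
  move=> c x y; rewrite /theta scaler_sumr -big_split; apply: eq_bigr => i _ /=.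
  by rewrite tensD tensZ (tens_linearl te).
have theta_elt a b : theta (elt alpha beta a b) = t a b.
  exact: (@elt_sum _ _ _ alpha beta _ t a b (tens_linearl te) (tens_linearr te)).
have theta0 : theta 0 = 0 := lin0 theta_lin.
have thetaD x y : theta (x + y) = theta x + theta y := linD theta_lin x y.
have thetaM x y : theta (x ** y) = theta x ** theta y.
  elim/tens_ind: x => [|x x' IH IH'|a b].
  - by rewrite cmul0r theta0 cmul0r.
  - by rewrite cmulDl !thetaD cmulDl IH IH'.
  elim/tens_ind: y => [|y y' IH IH'|a' b'].
  - by rewrite cmulr0 theta0 cmulr0.
  - by rewrite cmulDr !thetaD cmulDr IH IH'.
  by rewrite [_ ** _]tmul_elt !theta_elt (tens_mul te).
have theta_star x : theta (star x) = star (theta x).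
  elim/tens_ind: x => [|x x' IH IH'|a b].
  - by rewrite star0 theta0 star0.
  - by rewrite starD !thetaD starD IH IH'.
  by rewrite [star _]tstar_elt !theta_elt (tens_star te).
have theta_inj x : theta x = 0 -> x = 0.
  move=> x0; apply/ffunP=> i; rewrite ffunE.
  exact: (tens_inj te (@basis_lin_indep _ beta) x0).
have <- : theta (tens_sum (elt alpha beta : A -> B -> tensor) s) = tens_sum t s.
  by rewrite /tens_sum (lin_sum theta_lin); apply: eq_bigr => p _.
set x := tens_sum _ s.
have [x0|[y y0]] := tnorm_eigen x; first by rewrite tnormE x0.
rewrite -/(x ** y) -/(star x ** (x ** y)) => /(congr1 (Num.norm \o theta)).
rewrite /= cmulA thetaM (linZ theta_lin) normrZ => eig.
have ty : 0 < `|theta y|.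
  by rewrite normr_gt0; apply: contra_notN y0 => /eqP/theta_inj.
rewrite tnormE -(@ler_pXn2r _ 2)// ?nnegrE ?tnorm_ge0//.
rewrite -[leLHS]ger0_norm ?exprn_ge0 ?tnorm_ge0// -(ler_pM2r ty) -eig.
by rewrite thetaM theta_star -cstar_norm cmul_norm.
Qed.

Lemma elt_min_tensor : is_min_tensor (elt alpha beta : A -> B -> tensor).
Proof.
split; [exact: elt_tensor_embedding| |exact: tnorm_min].
move=> O [x Ox] _; exists x; split=> //.
by have [s sx] := tens_sum_surj x; exists s.
Qed.

(** The quantum family of constant maps: it is dual to the projection
    (x, d) |-> d. *)
Lemma right_leg_mor :
  is_mor (fun b => embed (elt alpha beta (one alpha) b : tensor)).
Proof.
split=> [c b b'|b b'|b|].
- apply: multiplier_eq => x /=.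
    by rewrite (elt_linearr _ _ _ c) cmulDl cmulZl.
  by rewrite (elt_linearr _ _ _ c) cmulDr cmulZr.
- have E : elt alpha beta (one alpha) (b ** b') =
      elt alpha beta (one alpha) b ** elt alpha beta (one alpha) b' :> tensor.
    by rewrite [RHS]tmul_elt (oneP alpha _).1.
  by apply: multiplier_eq => x /=; rewrite E cmulA.
- have E : elt alpha beta (one alpha) (star b) =
      star (elt alpha beta (one alpha) b : tensor).
    by rewrite [RHS]tstar_elt (is_unit_star (oneP alpha)).
  by apply: multiplier_eq => x /=; rewrite E starM starK.
move=> O [x Ox] _; exists x; split=> //; exists [:: (one beta, x)] => //.
by rewrite big_seq1 /=; exact: tmul1l.
Qed.

End MinimalTensor.

Theorem proposition4p6 (R : realType) (M A MA AA MAA : cstarAlgType R)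
    (tMA : M -> A -> MA) (tAA : A -> A -> AA)
    (tMA_A : MA -> A -> MAA) (tM_AA : M -> AA -> MAA)
    (Phi : M -> multiplier MA) (Delta : A -> multiplier AA) :
  finite_dim M ->
  quantum_semigroup_of_all_maps tMA tAA tMA_A tM_AA Phi Delta ->
  ergodic tMA Phi.
Proof.
move=> /trace_basis_exists[alpha] [[_ _ _ univ] _ _ _ _ _ _] IA m _ Phi_m.
exists (one alpha); first exact: oneP.
(* A zero m has no nonzero coefficient to compare. *)
have [m0|/eqP m_neq0] := m =P 0; first by exists 0; rewrite m0 scale0r.
have [Lambda [[_ [idL [_ idLl _] [G [_ _ _ _ GE] PsiE]]] _]] :=
  univ _ _ _ _ (elt_min_tensor alpha alpha) (right_leg_mor alpha alpha).
(* 1 (x) m = m (x) q comes from applying both multipliers to 1 (x) 1. *)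
pose q := lact (Lambda IA) (one alpha).
have eq_mq : elt alpha alpha (one alpha) m = elt alpha alpha m q.
  have := PsiE m; rewrite Phi_m GE.
  move=> /(congr1 (fun u => lact u (tunit alpha alpha))).
  by rewrite idLl [LHS]tmul1r /= (oneP alpha m).2.
(* The i-th right coefficients give c 1 = d m with c nonzero; so d is
   nonzero too. *)
have [i mi] : exists i, trace_form (tr alpha) (basis alpha i) m != 0.
  apply: contrapT => /forallNP m_eq0; case/negP: m_neq0.
  rewrite ((basisP alpha).2 m) big1// => i _.
  by have /negP/negPn/eqP-> := m_eq0 i; rewrite scale0r.
have /ffunP/(_ i) := eq_mq; rewrite !ffunE.
set c := trace_form _ _ _ in mi *; set d := trace_form _ _ _ => cd.
have d0 : d != 0.
  apply: contraNneq m_neq0 => d0; rewrite d0 scale0r in cd.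
  have one0 : one alpha = 0 by apply: (scalerI mi); rewrite cd scaler0.
  by rewrite -(oneP alpha m).1 one0 cmul0r.
exists (d^-1 * c); apply: (scalerI d0).
by rewrite -cd scalerA mulrA divff// mul1r.
Qed.
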